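(* Let $\varphi_e$ and $\varphi_{e_1}$ form a Mannheim surface offset, with dual Lorentzian offset angle $\bar\theta=\theta+\varepsilon\theta^*$. Then $\varphi_e$ is developable if and only if the offset distance is constant, i.e. $\theta^*=c^*=\text{constant}$.
   Context: Minkowski space $\mathbb{R}^3_1$ is $\mathbb{R}^3$ with $\langle \vec a,\vec b\rangle=-a_1b_1+a_2b_2+a_3b_3$, and the Lorentzian cross product is $\vec a\times\vec b=(a_2b_3-a_3b_2,\ a_1b_3-a_3b_1,\ a_2b_1-a_1b_2)$. Dual numbers are $a+\varepsilon a^*$ with $a,a^*\in\mathbb{R}$, $\varepsilon^2=0$; dual vectors are $\vec a+\varepsilon\vec a^*$ with $\vec a,\vec a^*\in\mathbb{R}^3_1$; inner and cross products extend bilinearly over the dual numbers. A differentiable real function $f$ extends to dual numbers by $f(x+\varepsilon x^* )=f(x)+\varepsilon x^*f'(x)$. First surface (spacelike ruled surface): $\varphi_e(s,v)=\vec c(s)+v\,\vec e(s)$ with smooth $\vec c,\vec e$ on an interval containing $0$, $\langle\vec e,\vec e\rangle=1$, $\langle\vec e\,',\vec e\,'\rangle=-1$, $\langle\vec c\,',\vec e\,'\rangle=0$ (prime is $d/ds$; $s$ is the arc-length of the indicatrix $\vec e$, and $\vec c$ is the striction curve). Put $\vec t=\vec e\,'$, $\vec g=-\vec e\times\vec t$, $\Delta=\det(\vec c\,',\vec e,\vec t)$, and $\tilde x=\vec x+\varepsilon\,\vec c\times\vec x$ for $\vec x=\vec e,\vec t,\vec g$. The surface $\varphi_e$ is developable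 if and only if $\Delta=0$ (identically). The dual arc-length is $\bar s=s+\varepsilon s^*$, $s^*=\int_0^s\Delta\,du$. The dual Darboux frame $\{\tilde e,\tilde t,\tilde g\}$ satisfies $\frac{d\tilde e}{d\bar s}=\tilde t$, $\frac{d\tilde t}{d\bar s}=\tilde e+\bar\gamma\tilde g$, $\frac{d\tilde g}{d\bar s}=\bar\gamma\tilde t$ for a dual function $\bar\gamma$. Second surface (timelike ruled surface with timelike rulings): $\varphi_{e_1}(s_1,v)=\vec c_1(s_1)+v\,\vec e_1(s_1)$ with $\langle\vec e_1,\vec e_1\rangle=-1$, $s_1$ the arc-length of the indicatrix $\vec e_1$, $\vec t_1=\frac{d\vec e_1}{ds_1}$ with $\langle\vec t_1,\vec t_1\rangle=1$, $\langle\frac{d\vec c_1}{ds_1},\vec t_1\rangle=0$ ($\vec c_1$ is the striction curve). Put $\Delta_1=\det(\frac{d\vec c_1}{ds_1},\vec e_1,\vec t_1)$. Its dual arc-length is $\bar s_1=s_1+\varepsilon s_1^*$, $s_1^*=-\int_0^{s_1}\Delta_1du_1$. Its dual Darboux frame is $\{\tilde e_1,\tilde t_1,\tilde g_1\}$, $\tilde x_1=\vec x_1+\varepsilon\,\vec c_1\times\vec x_1$, with $\tilde t_1=\frac{d\tilde e_1}{d\bar s_1}$. Mannheim offsets: $\varphi_e$ and $\varphi_{e_1}$ (with corresponding points, $s_1$ being a regular function of $s$) form a Mannheim surface offset if $\tilde g(\bar s)=\tilde t_1(\bar s_1)$. The frames are then related by $$\tilde e_1=\sinh\bar\theta\,\tilde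 e+\cosh\bar\theta\,\tilde t,\quad \tilde t_1=\tilde g,\quad \tilde g_1=\cosh\bar\theta\,\tilde e+\sinh\bar\theta\,\tilde t,$$ where the dual function $\bar\theta=\theta+\varepsilon\theta^*$ is the dual Lorentzian offset angle; the real functions $\theta$ and $\theta^*$ are called the offset angle and the offset distance. *)

(* Defs.v *)
From Stdlib Require Import Reals Lra Psatz.
From Coquelicot Require Import Coquelicot.
Open Scope R_scope.

(** * Minkowski 3-space *)

Record vec3 := Vec3 { x1 : R; x2 : R; x3 : R }.

Definition vzero : vec3 := Vec3 0 0 0.
Definition vadd (a b : vec3) : vec3 := Vec3 (x1 a + x1 b) (x2 a + x2 b) (x3 a + x3 b).
Definition vscal (k : R) (a : vec3) : vec3 := Vec3 (k * x1 a) (k * x2 a) (k * x3 a).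
Definition vopp (a : vec3) : vec3 := Vec3 (- x1 a) (- x2 a) (- x3 a).

Definition lprod (a b : vec3) : R := - (x1 a * x1 b) + x2 a * x2 b + x3 a * x3 b.

(* With this sign convention, lprod (lcross a b) d = - det3 a b d. *)
Definition lcross (a b : vec3) : vec3 :=
  Vec3 (x2 a * x3 b - x3 a * x2 b)
       (x1 a * x3 b - x3 a * x1 b)
       (x2 a * x1 b - x1 a * x2 b).

Definition det3 (a b d : vec3) : R :=
  x1 a * (x2 b * x3 d - x3 b * x2 d)
  - x2 a * (x1 b * x3 d - x3 b * x1 d)
  + x3 a * (x1 b * x2 d - x2 b * x1 d).

Definition collinear (a b : vec3) : Prop :=
  exists p q : R, (p <> 0 \/ q <> 0) /\ vadd (vscal p a) (vscal q b) = vzero.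

(** * Dual numbers and dual vectors *)

(* Dual a a' stands for a + eps a', with eps^2 = 0. *)
Record dual := Dual { re : R; du : R }.

Definition dual_ext (f : R -> R) (z : dual) : dual :=
  Dual (f (re z)) (du z * Derive f (re z)).

Definition dsinh : dual -> dual := dual_ext sinh.
Definition dcosh : dual -> dual := dual_ext cosh.

(* DVec a a' stands for a + eps a'. *)
Record dvec3 := DVec { dv_re : vec3; dv_du : vec3 }.

Definition dvadd (a b : dvec3) : dvec3 :=
  DVec (vadd (dv_re a) (dv_re b)) (vadd (dv_du a) (dv_du b)).
Definition dvscal (z : dual) (a : dvec3) : dvec3 :=
  DVec (vscal (re z) (dv_re a))
       (vadd (vscal (re z) (dv_du a)) (vscal (du z) (dv_re a))).

(** * Smooth curves on an interval *)

(* Any nondegenerate interval, open or not, bounded or not. *)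
Definition interval (J : R -> Prop) : Prop :=
  (exists a b, J a /\ J b /\ a < b) /\
  (forall a b x, J a -> J b -> a <= x <= b -> J x).

(* Curves are total functions; only their behaviour on the interval J matters.
   At an endpoint belonging to J, smoothness is that of an extension beyond it,
   and the two-sided derivative there equals the one-sided one. *)
Definition smooth_on (J : R -> Prop) (f : R -> R) : Prop :=
  forall (n : nat) (s : R), J s -> ex_derive_n f n s.

Definition vsmooth_on (J : R -> Prop) (f : R -> vec3) : Prop :=
  smooth_on J (fun s => x1 (f s)) /\
  smooth_on J (fun s => x2 (f s)) /\
  smooth_on J (fun s => x3 (f s)).

Definition vderive (f : R -> vec3) (s : R) : vec3 :=
  Vec3 (Derive (fun u => x1 (f u)) s)
       (Derive (fun u => x2 (f u)) s)
       (Derive (fun u => x3 (f u)) s).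

(** * Ruled surfaces *)

Definition ruled (c e : R -> vec3) (s v : R) : vec3 := vadd (c s) (vscal v (e s)).

Definition ruled_normal (c e : R -> vec3) (s v : R) : vec3 :=
  lcross (vderive (fun u => ruled c e u v) s) (vderive (fun w => ruled c e s w) v).

(* The tangent plane is the same at all regular points of each ruling (the normal
   vanishes at singular points, where the condition is void).
   [developable_iff_Delta] below gives the criterion Delta = 0. *)
Definition developable (J : R -> Prop) (c e : R -> vec3) : Prop :=
  forall s v w, J s -> collinear (ruled_normal c e s v) (ruled_normal c e s w).

(* The same sign of g serves both surfaces: given the first two relations between the
   frames of a Mannheim offset, the third one forces g1 = - e1 x t1. *)
Definition frame_t (e : R -> vec3) (s : R) : vec3 := vderive e s.
Definition frame_g (e : R -> vec3) (s : R) : vec3 := vopp (lcross (e s) (frame_t e s)).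

Definition Delta (c e : R -> vec3) (s : R) : R := det3 (vderive c s) (e s) (frame_t e s).

(* The dual vector of the line through c s with direction x s. *)
Definition tilde (c x : R -> vec3) (s : R) : dvec3 := DVec (x s) (lcross (c s) (x s)).

Record spacelike_ruled_surface (J : R -> Prop) (c e : R -> vec3) : Prop := {
  sp_interval : interval J;
  sp_zero : J 0;
  sp_smooth_c : vsmooth_on J c;
  sp_smooth_e : vsmooth_on J e;
  sp_ruling : forall s, J s -> lprod (e s) (e s) = 1;
  sp_arclength : forall s, J s -> lprod (frame_t e s) (frame_t e s) = -1;
  sp_striction : forall s, J s -> lprod (vderive c s) (frame_t e s) = 0 }.

Record timelike_ruled_surface (J : R -> Prop) (c e : R -> vec3) : Prop := {
  tl_interval : interval J;
  tl_zero : J 0;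
  tl_smooth_c : vsmooth_on J c;
  tl_smooth_e : vsmooth_on J e;
  tl_ruling : forall s, J s -> lprod (e s) (e s) = -1;
  tl_arclength : forall s, J s -> lprod (frame_t e s) (frame_t e s) = 1;
  tl_striction : forall s, J s -> lprod (vderive c s) (frame_t e s) = 0 }.

(** * Mannheim offsets *)

(* sigma gives the parameter s1 = sigma s of the ruling of the second surface
   corresponding to the ruling s of the first one. The dual frames, which may be
   parametrised by the dual arc-lengths s + eps s^* and s1 + eps s1^*, are evaluated
   here at the rulings with real parameters s and sigma s. *)
Record mannheim_offset (J J1 : R -> Prop) (c e c1 e1 : R -> vec3) (sigma : R -> R)
    : Prop := {
  mo_maps : forall s, J s -> J1 (sigma s);
  mo_smooth : smooth_on J sigma;
  mo_regular : forall s, J s -> Derive sigma s <> 0;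
  mo_offset : forall s, J s ->
    tilde c (frame_g e) s = tilde c1 (frame_t e1) (sigma s) }.

Definition dual_offset_angle (J : R -> Prop) (c e c1 e1 : R -> vec3) (sigma : R -> R)
    (thetabar : R -> dual) : Prop :=
  forall s, J s ->
    tilde c1 e1 (sigma s) =
      dvadd (dvscal (dsinh (thetabar s)) (tilde c e s))
            (dvscal (dcosh (thetabar s)) (tilde c (frame_t e) s)) /\
    tilde c1 (frame_g e1) (sigma s) =
      dvadd (dvscal (dcosh (thetabar s)) (tilde c e s))
            (dvscal (dsinh (thetabar s)) (tilde c (frame_t e) s)).

Definition offset_distance (thetabar : R -> dual) (s : R) : R := du (thetabar s).

(** * Developability in terms of Delta *)

Lemma ruled_normalE (J : R -> Prop) (c e : R -> vec3) (s v : R) :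
  vsmooth_on J c -> vsmooth_on J e -> J s ->
  ruled_normal c e s v =
    vadd (lcross (vderive c s) (e s)) (vscal v (lcross (frame_t e s) (e s))).
Proof.
intros [C1 [C2 C3]] [E1 [E2 E3]] Js.
assert (H : forall f g : R -> R, smooth_on J f -> smooth_on J g ->
  Derive (fun u => f u + v * g u) s = Derive f s + v * Derive g s).
{ intros f g Hf Hg. apply is_derive_unique.
  assert (Df := Hf 1%nat s Js). assert (Dg := Hg 1%nat s Js).
  apply (is_derive_plus f (fun u => v * g u)).
  - now apply Derive_correct.
  - apply is_derive_scal. now apply Derive_correct. }
assert (K : forall a b : R, Derive (fun w => a + w * b) v = b).
{ intros a b. apply is_derive_unique. auto_derive; [easy | ring]. }
unfold ruled_normal, vderive, ruled, vadd, vscal; cbn [x1 x2 x3].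
rewrite !K.
rewrite (H _ _ C1 E1), (H _ _ C2 E2), (H _ _ C3 E3).
unfold frame_t, lcross, vderive; cbn [x1 x2 x3].
f_equal; ring.
Qed.

Lemma collinear_lcross (a b : vec3) : lcross a b = vzero -> collinear a b.
Proof.
destruct a as [a1 a2 a3], b as [b1 b2 b3].
unfold collinear, lcross, vzero, vadd, vscal; cbn [x1 x2 x3].
intros H; injection H as H1 H2 H3.
destruct (Req_dec a1 0) as [A1|A1].
- destruct (Req_dec a2 0) as [A2|A2].
  + destruct (Req_dec a3 0) as [A3|A3].
    * exists 1, 0. split; [left; lra | subst; f_equal; ring].
    * exists (- b3), a3. split; [now right | f_equal; lra].
  + exists (- b2), a2. split; [now right | f_equal; lra].
- exists (- b1), a1. split; [now right | f_equal; lra].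
Qed.

Lemma developable_iff_Delta (J : R -> Prop) (c e : R -> vec3) :
  spacelike_ruled_surface J c e ->
  developable J c e <-> (forall s, J s -> Delta c e s = 0).
Proof.
intros [_ _ Hc He _ _ _]. split; intros H s.
- intros Js. destruct (H s 0 1 Js) as [p [q [Hpq E]]]. revert E.
  rewrite !(ruled_normalE J) by assumption.
  unfold Delta. generalize (vderive c s) (e s) (frame_t e s).
  intros [a1 a2 a3] [b1 b2 b3] [d1 d2 d3].
  unfold vzero, vadd, vscal, lcross, det3; cbn [x1 x2 x3].
  intros E; injection E as E1 E2 E3.
  match goal with |- ?D = 0 => set (DD := D) end.
  assert (F1 : (p + q) * DD = 0).
  { transitivity (d1 * (p * (a2 * b3 - a3 * b2 + 0 * (d2 * b3 - d3 * b2)) +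
       q * (a2 * b3 - a3 * b2 + 1 * (d2 * b3 - d3 * b2)))
     - d2 * (p * (a1 * b3 - a3 * b1 + 0 * (d1 * b3 - d3 * b1)) +
       q * (a1 * b3 - a3 * b1 + 1 * (d1 * b3 - d3 * b1)))
     - d3 * (p * (a2 * b1 - a1 * b2 + 0 * (d2 * b1 - d1 * b2)) +
       q * (a2 * b1 - a1 * b2 + 1 * (d2 * b1 - d1 * b2)))).
    - unfold DD; ring.
    - rewrite E1, E2, E3; ring. }
  assert (F2 : q * DD = 0).
  { transitivity (- (a1 * (p * (a2 * b3 - a3 * b2 + 0 * (d2 * b3 - d3 * b2)) +
       q * (a2 * b3 - a3 * b2 + 1 * (d2 * b3 - d3 * b2)))
     - a2 * (p * (a1 * b3 - a3 * b1 + 0 * (d1 * b3 - d3 * b1)) +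
       q * (a1 * b3 - a3 * b1 + 1 * (d1 * b3 - d3 * b1)))
     - a3 * (p * (a2 * b1 - a1 * b2 + 0 * (d2 * b1 - d1 * b2)) +
       q * (a2 * b1 - a1 * b2 + 1 * (d2 * b1 - d1 * b2))))).
    - unfold DD; ring.
    - rewrite E1, E2, E3; ring. }
  destruct (Rmult_integral _ _ F2) as [Q|]; [|assumption].
  destruct (Rmult_integral _ _ F1) as [P|]; [|assumption].
  lra.
- intros v w Js. specialize (H s Js). apply collinear_lcross.
  rewrite !(ruled_normalE J) by assumption.
  revert H. unfold Delta. generalize (vderive c s) (e s) (frame_t e s).
  intros [a1 a2 a3] [b1 b2 b3] [d1 d2 d3].
  unfold vzero, vadd, vscal, lcross, det3; cbn [x1 x2 x3].
  match goal with |- ?D = 0 -> _ => set (DD := D) end; intros H.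
  f_equal.
  + transitivity ((v - w) * b1 * DD); [unfold DD; ring | rewrite H; ring].
  + transitivity ((v - w) * b2 * DD); [unfold DD; ring | rewrite H; ring].
  + transitivity ((v - w) * b3 * DD); [unfold DD; ring | rewrite H; ring].
Qed.

(* Main.v *)
(** The first two relations between the dual frames say that [c1 = c + theta^* g]
    along corresponding rulings. Hence [theta^* = <c1 - c, g>], and since [g'] is
    orthogonal to [g] and [c1'] is orthogonal to [t1 = g], the function [theta^*]
    has derivative [- <c', g> = - Delta]. *)
Require Import Defs.
From Stdlib Require Import Reals Lra.
From Coquelicot Require Import Coquelicot.
Open Scope R_scope.

(** * Algebra of the Lorentzian inner and cross products *)

Lemma lprod_comm (a b : vec3) : lprod a b = lprod b a.
Proof. unfold lprod; ring. Qed.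

Lemma lprod_addl (a b d : vec3) : lprod (vadd a b) d = lprod a d + lprod b d.
Proof. unfold lprod, vadd; cbn; ring. Qed.

Lemma lprod_scall (k : R) (a b : vec3) : lprod (vscal k a) b = k * lprod a b.
Proof. unfold lprod, vscal; cbn; ring. Qed.

Lemma lprod_oppl (a b : vec3) : lprod (vopp a) b = - lprod a b.
Proof. unfold lprod, vopp; cbn; ring. Qed.

Lemma lprod_oppr (a b : vec3) : lprod a (vopp b) = - lprod a b.
Proof. unfold lprod, vopp; cbn; ring. Qed.

(** Lagrange's identity; in this signature its sign is opposite to the Euclidean one. *)
Lemma lprod_lcross (a b d f : vec3) :
  lprod (lcross a b) (lcross d f) = lprod a f * lprod b d - lprod a d * lprod b f.
Proof. unfold lprod, lcross; cbn; ring. Qed.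

Lemma lcross_diag (a : vec3) : lcross a a = vzero.
Proof. unfold lcross, vzero; f_equal; ring. Qed.

Lemma lcross_addl (a b d : vec3) :
  lcross (vadd a b) d = vadd (lcross a d) (lcross b d).
Proof. unfold lcross, vadd; cbn; f_equal; ring. Qed.

Lemma lcross_oppl (a b : vec3) : lcross (vopp a) b = vopp (lcross a b).
Proof. unfold lcross, vopp; cbn; f_equal; ring. Qed.

(** Follows from the triple product expansion [(w x g) x g = <g,g> w - <w,g> g], whose left side
    vanishes here. *)
Lemma lcross_unit_eq0 (w g : vec3) :
  lprod g g = 1 -> lcross w g = vzero -> w = vscal (lprod w g) g.
Proof.
intros Hg Hw.
assert (E : vadd (vscal (lprod g g) w) (vopp (vscal (lprod w g) g))
            = lcross (lcross w g) g).
{ unfold lprod, lcross, vadd, vscal, vopp; cbn; f_equal; ring. }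
rewrite Hw, Hg in E. revert E.
generalize (lprod w g); intros k.
destruct w as [w1 w2 w3], g as [g1 g2 g3].
unfold lcross, vadd, vscal, vopp, vzero; cbn.
intros E; injection E as E1 E2 E3. f_equal; lra.
Qed.

(** * Differentiation of vector-valued functions, and constancy on an interval *)

(** Unlike [vderive], which rests on the total [Derive], this relation also records
    differentiability. *)
Definition is_vderive (f : R -> vec3) (s : R) (l : vec3) : Prop :=
  is_derive (fun u => x1 (f u)) s (x1 l) /\
  is_derive (fun u => x2 (f u)) s (x2 l) /\
  is_derive (fun u => x3 (f u)) s (x3 l).

Lemma vderive_correct (J : R -> Prop) (f : R -> vec3) (s : R) :
  vsmooth_on J f -> J s -> is_vderive f s (vderive f s).
Proof.
intros [H1 [H2 H3]] Js.
split; [|split]; apply Derive_correct;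
  [apply (H1 1%nat) | apply (H2 1%nat) | apply (H3 1%nat)]; exact Js.
Qed.

Lemma vsmooth_vderive (J : R -> Prop) (f : R -> vec3) (s : R) :
  vsmooth_on J f -> J s -> is_vderive (vderive f) s (vderive (vderive f) s).
Proof.
intros [H1 [H2 H3]] Js.
split; [|split]; apply Derive_correct;
  [apply (H1 2%nat) | apply (H2 2%nat) | apply (H3 2%nat)]; exact Js.
Qed.

Lemma is_vderive_comp (f : R -> vec3) (h : R -> R) (s k : R) (l : vec3) :
  is_vderive f (h s) l -> is_derive h s k ->
  is_vderive (fun u => f (h u)) s (vscal k l).
Proof.
intros [H1 [H2 H3]] Hh.
split; [|split];
  [ apply (is_derive_comp (fun u => x1 (f u)) h)
  | apply (is_derive_comp (fun u => x2 (f u)) h)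
  | apply (is_derive_comp (fun u => x3 (f u)) h) ]; assumption.
Qed.

Lemma is_vderive_opp (f : R -> vec3) (s : R) (l : vec3) :
  is_vderive f s l -> is_vderive (fun u => vopp (f u)) s (vopp l).
Proof.
intros [H1 [H2 H3]].
split; [|split]; cbn;
  [ apply (is_derive_opp (fun u => x1 (f u)))
  | apply (is_derive_opp (fun u => x2 (f u)))
  | apply (is_derive_opp (fun u => x3 (f u))) ]; assumption.
Qed.

Lemma is_vderive_add (f h : R -> vec3) (s : R) (l m : vec3) :
  is_vderive f s l -> is_vderive h s m ->
  is_vderive (fun u => vadd (f u) (h u)) s (vadd l m).
Proof.
intros [H1 [H2 H3]] [K1 [K2 K3]].
split; [|split]; cbn;
  [ apply (is_derive_plus (fun u => x1 (f u)) (fun u => x1 (h u)))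
  | apply (is_derive_plus (fun u => x2 (f u)) (fun u => x2 (h u)))
  | apply (is_derive_plus (fun u => x3 (f u)) (fun u => x3 (h u))) ]; assumption.
Qed.

Lemma is_derive_eq (f : R -> R) (s l m : R) :
  is_derive f s l -> l = m -> is_derive f s m.
Proof. now intros H <-. Qed.

Lemma is_derive_Rmult (f h : R -> R) (s l m : R) :
  is_derive f s l -> is_derive h s m ->
  is_derive (fun u => f u * h u) s (l * h s + f s * m).
Proof.
intros Hf Hh. apply (is_derive_mult f h); auto.
intros; apply Rmult_comm.
Qed.

Lemma is_derive_Rminus (f h : R -> R) (s l m : R) :
  is_derive f s l -> is_derive h s m -> is_derive (fun u => f u - h u) s (l - m).
Proof. exact (is_derive_minus f h s l m). Qed.

Lemma is_derive_lprod (f h : R -> vec3) (s : R) (l m : vec3) :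
  is_vderive f s l -> is_vderive h s m ->
  is_derive (fun u => lprod (f u) (h u)) s (lprod l (h s) + lprod (f s) m).
Proof.
intros [H1 [H2 H3]] [K1 [K2 K3]].
assert (P1 := is_derive_Rmult _ _ _ _ _ H1 K1).
assert (P2 := is_derive_Rmult _ _ _ _ _ H2 K2).
assert (P3 := is_derive_Rmult _ _ _ _ _ H3 K3).
assert (P := is_derive_plus _ _ _ _ _
  (is_derive_plus _ _ _ _ _ (is_derive_opp _ _ _ P1) P2) P3).
refine (is_derive_eq _ _ _ _ P _).
unfold lprod, plus, opp; cbn; ring.
Qed.

Lemma is_vderive_lcross (f h : R -> vec3) (s : R) (l m : vec3) :
  is_vderive f s l -> is_vderive h s m ->
  is_vderive (fun u => lcross (f u) (h u)) s (vadd (lcross l (h s)) (lcross (f s) m)).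
Proof.
intros [H1 [H2 H3]] [K1 [K2 K3]].
assert (D : forall a b a' b' : R -> R, forall la lb la' lb' : R,
  is_derive a s la -> is_derive b s lb -> is_derive a' s la' -> is_derive b' s lb' ->
  is_derive (fun u => a u * b u - a' u * b' u) s
    (la * b s - la' * b' s + (a s * lb - a' s * lb'))).
{ intros a b a' b' la lb la' lb' A B A' B'.
  refine (is_derive_eq _ _ _ _ (is_derive_Rminus _ _ _ _ _
    (is_derive_Rmult _ _ _ _ _ A B) (is_derive_Rmult _ _ _ _ _ A' B')) _).
  ring. }
split; [|split]; cbn.
- exact (D _ _ _ _ _ _ _ _ H2 K3 H3 K2).
- exact (D _ _ _ _ _ _ _ _ H1 K3 H3 K1).
- exact (D _ _ _ _ _ _ _ _ H2 K1 H1 K2).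
Qed.

(* Also covers endpoints of [J], where [f] need not be constant on a neighbourhood. *)
Lemma is_derive_const_on (J : R -> Prop) (f : R -> R) (s k l : R) :
  interval J -> J s -> (forall u, J u -> f u = k) -> is_derive f s l -> l = 0.
Proof.
intros [[a [b [Ja [Jb ab]]]] HJ] Js Hf Hl.
(* A second point of [J] fixes a side from which [s] can be approached inside [J]. *)
assert (Hp : exists p, J p /\ p <> s).
{ destruct (Req_dec a s) as [as_|as_]; [exists b | exists a]; split; auto; lra. }
destruct Hp as [p [Jp ps]].
destruct (Req_dec l 0) as [|l0]; [assumption | exfalso].
apply is_derive_Reals in Hl.
(* With tolerance [Rabs l], the zero difference quotient between two points of [J] yields
   [Rabs l < Rabs l]. *)
destruct (Hl (Rabs l) (Rabs_pos_lt _ l0)) as [[d d0] Hd]; cbn in Hd.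
assert (ps0 : 0 < Rabs (p - s)) by (apply Rabs_pos_lt; lra).
(* The bound 1 keeps [s + r * (p - s)] between [s] and [p], hence in [J]; the other bound makes the
   increment at most [d / 2]. *)
set (r := Rmin 1 (d / (2 * Rabs (p - s)))).
assert (q0 : 0 < d / (2 * Rabs (p - s))) by (apply Rdiv_lt_0_compat; lra).
assert (r0 : 0 < r) by (apply Rmin_glb_lt; lra).
assert (r1 : r <= 1) by apply Rmin_l.
assert (h0 : r * (p - s) <> 0) by (apply Rmult_integral_contrapositive_currified; lra).
assert (hd : Rabs (r * (p - s)) < d).
{ rewrite Rabs_mult, (Rabs_right r) by lra.
  apply Rle_lt_trans with (d / (2 * Rabs (p - s)) * Rabs (p - s)).
  - apply Rmult_le_compat_r; [lra | apply Rmin_r].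
  - replace (d / (2 * Rabs (p - s)) * Rabs (p - s)) with (d / 2) by (field; lra). lra. }
assert (Jh : J (s + r * (p - s))).
{ destruct (Rle_dec s p).
  - apply (HJ s p); auto; nra.
  - apply (HJ p s); auto; nra. }
specialize (Hd _ h0 hd). rewrite (Hf _ Jh), (Hf _ Js) in Hd.
replace ((k - k) / (r * (p - s)) - l) with (- l) in Hd
  by (unfold Rdiv; rewrite Rminus_diag; ring).
rewrite Rabs_Ropp in Hd. lra.
Qed.

Lemma constant_of_is_derive0 (J : R -> Prop) (f : R -> R) :
  interval J -> (forall s, J s -> is_derive f s 0) ->
  forall a b, J a -> J b -> f a = f b.
Proof.
intros [_ HJ] Hf.
assert (H : forall a b, J a -> J b -> a < b -> f a = f b).
{ intros a b Ja Jb ab. apply (eq_is_derive f); [|assumption].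
  intros t Ht. apply Hf, (HJ a b); assumption. }
intros a b Ja Jb.
destruct (Rtotal_order a b) as [ab|[ab|ab]];
  [now apply H | now subst | symmetry; now apply H].
Qed.

(** Two signs cancel: the one in [g = - e x t] and the one in [<a x b, d> = - det3 a b d]. *)
Lemma Delta_lprod (c e : R -> vec3) (s : R) :
  Defs.Delta c e s = lprod (vderive c s) (frame_g e s).
Proof. unfold Defs.Delta, frame_g, det3, lprod, vopp, lcross; cbn; ring. Qed.

(** * Orthogonality relations in the Darboux frame of the first surface *)

Section SpacelikeFrame.

Variables (J : R -> Prop) (c e : R -> vec3).
Hypothesis Hphi : spacelike_ruled_surface J c e.

Lemma lprod_e_t (s : R) : J s -> lprod (e s) (frame_t e s) = 0.
Proof.
intros Js. destruct Hphi as [HJ _ _ He Hee _ _].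
assert (D := vderive_correct J e s He Js).
assert (H := is_derive_const_on J _ s 1 _ HJ Js Hee (is_derive_lprod _ _ _ _ _ D D)).
rewrite (lprod_comm (vderive e s)) in H. unfold frame_t. lra.
Qed.

Lemma lprod_t_t' (s : R) : J s -> lprod (frame_t e s) (vderive (frame_t e) s) = 0.
Proof.
intros Js. destruct Hphi as [HJ _ _ He _ Htt _].
assert (D := vsmooth_vderive J e s He Js).
assert (H := is_derive_const_on J _ s (-1) _ HJ Js Htt (is_derive_lprod _ _ _ _ _ D D)).
rewrite (lprod_comm (vderive (vderive e) s)) in H. unfold frame_t.
change (vderive (fun s => vderive e s) s) with (vderive (vderive e) s). lra.
Qed.

(** Lagrange's identity gives [<e,t>^2 - <e,e> <t,t> = 0 - 1 * (-1)]. *)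
Lemma lprod_g_g (s : R) : J s -> lprod (frame_g e s) (frame_g e s) = 1.
Proof.
intros Js. unfold frame_g.
rewrite lprod_oppl, lprod_oppr, lprod_lcross.
rewrite (lprod_comm (frame_t e s) (e s)), (lprod_e_t s Js).
rewrite (sp_ruling _ _ _ Hphi s Js), (sp_arclength _ _ _ Hphi s Js). ring.
Qed.

(** Since [e' = t], the other term of the product rule is [t x t = 0]. *)
Lemma frame_g_derive (s : R) : J s ->
  is_vderive (frame_g e) s (vopp (lcross (e s) (vderive (frame_t e) s))).
Proof.
intros Js. assert (He := sp_smooth_e _ _ _ Hphi).
assert (D := is_vderive_opp _ _ _ (is_vderive_lcross _ _ _ _ _
  (vderive_correct J e s He Js) (vsmooth_vderive J e s He Js))).
rewrite lcross_diag in D.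
refine (eq_ind _ (is_vderive _ s) D _ _).
unfold vopp, vadd, vzero, lcross; cbn; f_equal; ring.
Qed.

(** By Lagrange's identity each term contains [<e,t>] or [<t,t'>], and both vanish. *)
Lemma lprod_g_g' (s : R) : J s ->
  lprod (frame_g e s) (vopp (lcross (e s) (vderive (frame_t e) s))) = 0.
Proof.
intros Js. unfold frame_g at 1.
rewrite lprod_oppl, lprod_oppr, lprod_lcross.
rewrite (lprod_comm (frame_t e s) (e s)), (lprod_e_t s Js), (lprod_t_t' s Js). ring.
Qed.

End SpacelikeFrame.

(** * The gap between the striction curves and the offset distance *)

Lemma Derive_sinh (x : R) : Derive sinh x = cosh x.
Proof. apply is_derive_unique, is_derive_Reals, derivable_pt_lim_sinh. Qed.

Lemma cosh_gt0 (x : R) : 0 < cosh x.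
Proof. unfold cosh. assert (H := exp_pos x). assert (K := exp_pos (- x)). lra. Qed.

(** Signed length, along [g], of the segment joining corresponding striction points; it is defined
    without the offset angle, so its derivative can be computed without assuming [thetabar]
    differentiable. *)
Definition striction_gap (c e c1 : R -> vec3) (sigma : R -> R) (s : R) : R :=
  lprod (vadd (c1 (sigma s)) (vopp (c s))) (frame_g e s).

Section Offset.

Variables (J J1 : R -> Prop) (c e c1 e1 : R -> vec3) (sigma : R -> R).
Hypotheses (Hphi : spacelike_ruled_surface J c e)
           (Hphi1 : timelike_ruled_surface J1 c1 e1)
           (Hoffset : mannheim_offset J J1 c e c1 e1 sigma).

(** The real part of the offset condition is [g = t1], and the dual part then reads
    [c x g = c1 x g]: both striction points lie on one line of direction [g], so
    [(c1 - c) x g = 0]. *)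
Lemma striction_gapE (s : R) : J s ->
  vadd (c1 (sigma s)) (vopp (c s))
  = vscal (striction_gap c e c1 sigma s) (frame_g e s).
Proof.
intros Js.
apply lcross_unit_eq0; [exact (lprod_g_g J c e Hphi s Js)|].
assert (T := mo_offset _ _ _ _ _ _ _ Hoffset s Js).
assert (T1 := f_equal dv_re T). assert (T2 := f_equal dv_du T). cbn in T1, T2.
rewrite lcross_addl, lcross_oppl, T2, T1.
unfold vadd, vopp, vzero; cbn; f_equal; ring.
Qed.

Lemma striction_gap_derive (s : R) : J s ->
  is_derive (striction_gap c e c1 sigma) s (- Defs.Delta c e s).
Proof.
intros Js.
assert (J1s := mo_maps _ _ _ _ _ _ _ Hoffset s Js).
assert (Dsigma : is_derive sigma s (Derive sigma s)).
{ apply Derive_correct, (mo_smooth _ _ _ _ _ _ _ Hoffset 1%nat s Js). }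
assert (Dc1 := is_vderive_comp c1 sigma s _ _
  (vderive_correct J1 c1 _ (tl_smooth_c _ _ _ Hphi1) J1s) Dsigma).
assert (Dc := vderive_correct J c s (sp_smooth_c _ _ _ Hphi) Js).
assert (D := is_derive_lprod _ _ _ _ _
  (is_vderive_add _ _ _ _ _ Dc1 (is_vderive_opp _ _ _ Dc))
  (frame_g_derive J c e Hphi s Js)).
refine (is_derive_eq _ _ _ _ D _).
(* The term [<c1 - c, g'>] vanishes because [c1 - c] is a multiple of [g]. *)
rewrite (striction_gapE s Js), lprod_scall, (lprod_g_g' J c e Hphi s Js).
rewrite lprod_addl, lprod_scall, lprod_oppl, <- Delta_lprod.
(* Replacing [g] by [t1] lets the striction condition of the second surface remove the [c1']
   term. *)
assert (T := f_equal dv_re (mo_offset _ _ _ _ _ _ _ Hoffset s Js)); cbn in T.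
rewrite T, (tl_striction _ _ _ Hphi1 _ J1s). ring.
Qed.

(** With [e1 = sinh th e + cosh th t] from the real part, the dual part of the first frame relation
    becomes [(c1 - c) x e1 = theta^* (cosh th e + sinh th t)]. Pairing it with [e] isolates
    [theta^* cosh th], and [cosh th > 0] can be cancelled. *)
Lemma offset_distanceE (thetabar : R -> dual) (s : R) :
  dual_offset_angle J c e c1 e1 sigma thetabar -> J s ->
  offset_distance thetabar s = striction_gap c e c1 sigma s.
Proof.
intros Hangle Js.
assert (Hw := striction_gapE s Js).
assert (Hg := lprod_g_g J c e Hphi s Js).
assert (Het := lprod_e_t J c e Hphi s Js).
assert (Hee := sp_ruling _ _ _ Hphi s Js).
destruct (Hangle s Js) as [E _].
assert (E1 := f_equal dv_re E). assert (E2 := f_equal dv_du E).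
cbn in E1, E2. clear E. rewrite Derive_sinh in E2.
rewrite E1 in E2. clear E1.
unfold offset_distance.
set (th := re (thetabar s)) in *. set (ths := du (thetabar s)) in *.
set (k := striction_gap c e c1 sigma s) in *.
assert (C := cosh_gt0 th).
apply Rmult_eq_reg_l with (cosh th); [|lra].
(* Both sides are the component along [e] of [(c1 - c) x e1]. *)
assert (E3 : lprod (lcross (vadd (c1 (sigma s)) (vopp (c s)))
    (vadd (vscal (sinh th) (e s)) (vscal (cosh th) (frame_t e s)))) (e s)
  = ths * (cosh th * lprod (e s) (e s)
     + Derive cosh th * lprod (e s) (frame_t e s))).
{ rewrite lcross_addl, lprod_addl, E2.
  unfold lprod, vopp, vadd, vscal, lcross; cbn; ring. }
(* Orthogonality of [e] and [t] eliminates the term in [Derive cosh]. *)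
rewrite Hee, Het in E3.
transitivity (ths * (cosh th * 1 + Derive cosh th * 0)); [ring|].
rewrite <- E3, Hw.
transitivity (cosh th * (k * lprod (frame_g e s) (frame_g e s))).
(* Expanding only one factor of [<g,g>] as [- e x t] leaves the triple product identity
   [<g x t, e> = - <g, e x t>]; the [sinh] term drops out since [<g x e, e> = 0]. *)
- unfold frame_g at 2.
  unfold lprod, vopp, vadd, vscal, lcross; cbn; ring.
- rewrite Hg; ring.
Qed.

End Offset.

Theorem corollary5p1
  (J J1 : R -> Prop) (c e c1 e1 : R -> vec3) (sigma : R -> R) (thetabar : R -> dual)
  (Hphi : spacelike_ruled_surface J c e)
  (Hphi1 : timelike_ruled_surface J1 c1 e1)
  (Hoffset : mannheim_offset J J1 c e c1 e1 sigma)
  (Hangle : dual_offset_angle J c e c1 e1 sigma thetabar) :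
  developable J c e <->
  (exists cstar : R, forall s : R, J s -> offset_distance thetabar s = cstar).
Proof.
assert (HJ := sp_interval _ _ _ Hphi).
assert (HD := striction_gap_derive J J1 c e c1 e1 sigma Hphi Hphi1 Hoffset).
assert (HE := fun s => offset_distanceE J J1 c e c1 e1 sigma Hphi Hoffset thetabar s Hangle).
rewrite (developable_iff_Delta J c e Hphi). split.
(* The constant is the value at the base point 0, which belongs to [J]; the gap has derivative
   [- Delta = 0] on [J]. *)
- intros H0. exists (striction_gap c e c1 sigma 0). intros s Js.
  rewrite (HE s Js).
  apply (constant_of_is_derive0 J _ HJ); [|assumption | exact (sp_zero _ _ _ Hphi)].
  intros u Ju. rewrite <- Ropp_0, <- (H0 u Ju). exact (HD u Ju).
- intros [k Hk] s Js.
  (* The gap equals [theta^*] on [J], so it is constant there and its derivative [- Delta] is zero,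
     also at endpoints of [J]. *)
  assert (H := is_derive_const_on J _ s k _ HJ Js
    (fun u Ju => eq_trans (eq_sym (HE u Ju)) (Hk u Ju)) (HD s Js)).
  lra.
Qed.
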